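(* Let $M=(E,r)$ be a $q$-matroid with $E=\mathbb{F}^n$, and let $e\subseteq E$ be a $1$-dimensional subspace that is neither a loop nor an isthmus of $M$. Then $M^*/e=(M|_{e^\perp})^*$ and $(M/e)^*=M^*|_{e^\perp}$, where $q$-matroids on $E/e$ and on $e^\perp$ are identified via the isomorphism $\varphi:E/e\to e^\perp$.
   Context: A $q$-matroid is a pair $(E,r)$ where $E$ is a finite dimensional vector space over a field and $r$ is an integer-valued function on the subspaces of $E$ satisfying (r1) $0\le r(A)\le\dim A$, (r2) $A\subseteq B\Rightarrow r(A)\le r(B)$, (r3) $r(A+B)+r(A\cap B)\le r(A)+r(B)$. Independent: $r(A)=\dim A$; basis: independent with $r(A)=r(E)$; loop: $1$-dimensional $x$ with $r(x)=0$; isthmus: a $1$-dimensional subspace not contained in $B^\perp$ for any basis $B$ (equivalently $e^\perp$ contains no basis). $\perp$ is with respect to the standard bilinear form on $E$. Dual: $M^*=(E,r^* )$, $r^*(A)=\dim A-r(E)+r(A^\perp)$; for a $q$-matroid on a space with a given nondegenerate bilinear form, the dual is defined the same way using that form (different forms give isomorphic duals). Restriction $M|_{e^\perp}$: the $q$-matroid on $e^\perp$ with rank $r(A)$ for $A\subseteq e^\perp$ (defined when $e^\perp$ contains a basis). Contraction $M/e$ (for $e$ not a loop): with $\pi:E\to E/e$ the projection, the $q$-matroid on $E/e$ with rank $r(B_A)-1$, where $B_A\supseteq e$ is the unique subspace with $\pi(B_A)=A$. The map $\varphi:E/e\to e^\perp$ sends $\pi(A)$ (for $A\supseteq e$) to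 the orthogonal complement of $e$ inside $A$; $e^\perp$ carries the restriction of the standard bilinear form, and $E/e$ carries the form $\langle\mathbf{x},\mathbf{y}\rangle_{E/e}=\langle\varphi(\mathbf{x}),\varphi(\mathbf{y})\rangle_{e^\perp}$; duals on $e^\perp$ and $E/e$ are taken with respect to these forms.
   Formalization: It is additionally assumed that the standard form restricted to e^⊥ is nondegenerate, i.e. e is not contained in e^⊥; for isotropic e the map φ is not an isomorphism and the duals on e^⊥ and E/e are not defined. *)

(* Defs.v *)
From HB Require Import structures.
From mathcomp Require Import all_boot all_order all_algebra.
From mathcomp Require Import generic_quotient ring_quotient sesquilinear.
From mathcomp Require Import zify.

Set Implicit Arguments.
Unset Strict Implicit.
Unset Printing Implicit Defensive.

Import Order.TTheory GRing.Theory Num.Theory.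
Local Open Scope ring_scope.
Local Open Scope quotient_scope.

Section QuotientSpace.
Variables (F : fieldType) (E : vectType F) (U : {vspace E}).

Definition quotv : Type := Quotient.quot (pred_of_vspace U).

HB.instance Definition _ := Choice.on quotv.
HB.instance Definition _ := GRing.Zmodule.on quotv.
HB.instance Definition _ := EqQuotient.on quotv.

Definition quotv_pi (x : E) : quotv := \pi_(Quotient.quot (pred_of_vspace U)) x.
Local Notation proj := quotv_pi.

Let rep (x : quotv) : E := repr (x : Quotient.quot (pred_of_vspace U)).

Let repK : cancel rep proj. Proof. exact: reprK. Qed.

Let projP (x y : E) : reflect (proj x = proj y) (x - y \in U).
Proof.
rewrite -[_ \in U]/(_ \in pred_of_vspace U) Quotient.idealrBE.
exact: eqP.
Qed.

Let projB : zmod_morphism proj.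
Proof. exact: (raddfB \pi_(Quotient.quot (pred_of_vspace U))). Qed.

Let projD x y : proj (x + y) = proj x + proj y.
Proof. exact: (raddfD \pi_(Quotient.quot (pred_of_vspace U))). Qed.

Definition quotv_scale (a : F) (x : quotv) : quotv := proj (a *: rep x).

Let projZ a x : proj (a *: x) = quotv_scale a (proj x).
Proof.
by apply/projP; rewrite -scalerBr memvZ //; apply/projP; rewrite repK.
Qed.

Fact quotv_scaleA a b x :
  quotv_scale a (quotv_scale b x) = quotv_scale (a * b) x.
Proof. by rewrite -[x]repK -!projZ scalerA. Qed.

Fact quotv_scale1 : left_id 1 quotv_scale.
Proof. by move=> x; rewrite -[x]repK -projZ scale1r. Qed.

Fact quotv_scaleDr : right_distributive quotv_scale +%R.
Proof.
by move=> a x y; rewrite -[x]repK -[y]repK -projD -!projZ scalerDr projD.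
Qed.

Fact quotv_scaleDl x : {morph quotv_scale^~ x : a b / a + b}.
Proof. by move=> a b; rewrite -[x]repK -!projZ scalerDl projD. Qed.

HB.instance Definition _ := GRing.Zmodule_isLmodule.Build F quotv
  quotv_scaleA quotv_scale1 quotv_scaleDr quotv_scaleDl.

Fact quotv_vect_iso : vector_axiom_def (\dim U^C) quotv.
Proof.
pose p := daddv_pi U^C U.
have capU : (U^C :&: U = 0)%VS by rewrite capvC capv_compl.
have addU x : p x + daddv_pi U U^C x = x.
  by apply: daddv_pi_add => //; rewrite addvC addv_complf memvf.
have subU x : x - p x \in U by rewrite -{1}(addU x) addrC addKr memv_pi.
have p0 x : x \in U -> p x = 0.
  move=> xU; apply/eqP; rewrite -memv0 -capU memv_cap memv_pi /=.
  by rewrite -[p x]opprK -[- p x](addKr x) memvN addrC rpredB // subU.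
pose f (x : quotv) : 'rV_(\dim U^C) := \row_i coord (vbasis U^C) i (p (rep x)).
have fE x : f (proj x) = \row_i coord (vbasis U^C) i (p x).
  apply/rowP=> i; rewrite !mxE; congr (coord _ i _); apply/eqP.
  by rewrite -subr_eq0 -(linearB p) /= p0 //; apply/projP; rewrite repK.
exists f.
  move=> a x y; rewrite -[x]repK -[y]repK.
  have -> : a *: proj (rep x) + proj (rep y) = proj (a *: rep x + rep y).
    by rewrite projD projZ.
  by rewrite !fE; apply/rowP=> i; rewrite !mxE linearP /= linearP.
pose g (v : 'rV_(\dim U^C)) : quotv := proj (\sum_i v 0 i *: (vbasis U^C)`_i).
exists g => [x | v].
  rewrite -[x]repK fE /g -[RHS](_ : proj (p (rep x)) = _); last first.
    by apply/esym/projP.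
  congr proj; rewrite [RHS](coord_vbasis (memv_pi _ _ _)).
  by apply: eq_bigr => i _; rewrite mxE.
rewrite fE; apply/rowP=> i; rewrite mxE daddv_pi_id //.
  by rewrite coord_sum_free // (basis_free (vbasisP _)).
by apply: memv_suml => j _; rewrite memvZ // vbasis_mem ?mem_nth ?size_tuple.
Qed.

HB.instance Definition _ := Lmodule_hasFinDim.Build F quotv quotv_vect_iso.

Fact projv_linear : linear (proj : E -> quotv).
Proof. by move=> a x y; rewrite projD projZ. Qed.

HB.instance Definition _ := GRing.isLinear.Build F E quotv _ proj projv_linear.

Definition quotv_proj : 'Hom(E, quotv) := linfun proj.

Lemma lker_quotv_proj : lker quotv_proj = U.
Proof.
apply/vspaceP=> x; rewrite memv_ker lfunE /= -(linear0 proj).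
by apply/eqP/idP => [/projP | xU]; [| apply/projP]; rewrite subr0.
Qed.

Lemma quotv_proj_eq0 x : (quotv_proj x == 0) = (x \in U).
Proof. by rewrite -memv_ker lker_quotv_proj. Qed.

Lemma limg_quotv_proj : limg quotv_proj = fullv.
Proof.
apply/eqP; rewrite eqEsubv subvf; apply/subvP=> x _.
by apply/memv_imgP; exists (rep x); rewrite ?memvf // lfunE /= repK.
Qed.

End QuotientSpace.

Section PullbackForm.
Variables (F : fieldType) (E1 E2 : vectType F).
Variables (f : 'Hom(E1, E2)) (b : {symmetric E2}).

Definition pullback_form (x y : E1) : F := b (f x) (f y).

Fact pullback_form_bilinear :
  bilinear_for (GRing.Scale.Law.clone _ _ *%R _)
               (GRing.Scale.Law.clone _ _ (idfun \; *%R) _) pullback_form.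
Proof.
by split=> [z|z] a x y; rewrite /pullback_form /= linearP /= ?linearPl ?linearPr.
Qed.

HB.instance Definition _ :=
  bilinear_isBilinear.Build F E1 E1 F _ _ pullback_form pullback_form_bilinear.

Fact pullback_form_sym x y :
  pullback_form x y = (-1) ^+ false * idfun (pullback_form y x).
Proof. by rewrite /pullback_form [LHS]hermC. Qed.

HB.instance Definition _ := isHermitianSesquilinear.Build F E1 false idfun
  pullback_form pullback_form_sym.

End PullbackForm.

Section StandardForm.
Variables (F : fieldType) (n : nat).

Definition dotrv (x y : 'rV[F]_n) : F := \sum_i x 0 i * y 0 i.

Fact dotrv_bilinear :
  bilinear_for (GRing.Scale.Law.clone _ _ *%R _)
               (GRing.Scale.Law.clone _ _ (idfun \; *%R) _) dotrv.
Proof.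
by split=> [z|z] a x y; rewrite /dotrv /= big_distrr -big_split /=;
  apply: eq_bigr => i _; rewrite !mxE ?mulrDl ?mulrDr ?mulrA // (mulrC a).
Qed.

HB.instance Definition _ :=
  bilinear_isBilinear.Build F 'rV[F]_n 'rV[F]_n F _ _ dotrv dotrv_bilinear.

Fact dotrv_sym x y : dotrv x y = (-1) ^+ false * idfun (dotrv y x).
Proof. by rewrite mul1r; apply: eq_bigr => i _; rewrite mulrC. Qed.

HB.instance Definition _ :=
  isHermitianSesquilinear.Build F 'rV[F]_n false idfun dotrv dotrv_sym.

Lemma dotrv_nondegenerate : nondegenerate dotrv.
Proof.
rewrite /nondegenerate -subv0; apply/subvP=> x /mem_orthovP x0.
rewrite memv0; apply/eqP/rowP=> i; rewrite mxE.
rewrite -(x0 (delta_mx 0 i)) ?memvf //= /dotrv (bigD1 i) //= mxE !eqxx mulr1.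
by rewrite big1 ?addr0 // => j /negPf ji; rewrite mxE ji andbF mulr0.
Qed.

End StandardForm.

Arguments dotrv : clear implicits.

Section Orthogonal.
Variables (F : fieldType) (E : vectType F) (b : {symmetric E}).
Implicit Types A B V : {vspace E}.

Lemma orthovS A B : (A <= B)%VS -> (orthov b B <= orthov b A)%VS.
Proof.
move=> sAB; apply/orthovP=> u v uB vA.
by move/mem_orthovP: uB; apply; apply: (subvP sAB).
Qed.

Lemma orthov_add A B : orthov b (A + B) = (orthov b A :&: orthov b B)%VS.
Proof.
apply/eqP; rewrite eqEsubv subv_cap !orthovS ?addvSl ?addvSr //=.
by rewrite orthovD capvSl capvSr.
Qed.

Lemma dim_le_cap_orthov A V : (\dim A <= \dim (A :&: orthov b V) + \dim V)%N.
Proof.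
have lin : linear (fun x => \row_i b x (vbasis V)`_i : 'rV_(\dim V)).
  by move=> a x y; apply/rowP=> i; rewrite !mxE linearPl.
pose g_ : E -> 'rV[F]_(\dim V) := fun x => \row_i b x (vbasis V)`_i.
pose L := GRing.isLinear.Build _ _ _ _ g_ lin.
pose gl : {linear E -> 'rV[F]_(\dim V)} := HB.pack g_ L.
pose g := linfun gl.
have kg : lker g = orthov b V.
  apply/vspaceP=> x; rewrite memv_ker lfunE /=.
  apply/eqP/mem_orthovP => [/rowP gx v vV | xV].
    rewrite (coord_vbasis vV) linear_sumr big1 // => i _.
    by have := gx i; rewrite !mxE linearZr /= => ->; rewrite mulr0.
  apply/rowP=> i; rewrite !mxE xV //.
  by rewrite vbasis_mem ?mem_nth ?size_tuple.
rewrite -{1}(limg_ker_dim g A) kg leq_add2l.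
by apply: leq_trans (dimvS (subvf _)) _; rewrite dimvf /dim /= mul1n.
Qed.

Hypothesis nd : nondegenerate b.

Lemma dim_orthov A : (\dim (orthov b A) + \dim A)%N = \dim {:E}.
Proof.
apply/eqP; rewrite eqn_leq; apply/andP; split; last first.
  by have := dim_le_cap_orthov fullv A; rewrite capfv.
pose W := orthov b A.
have c0 : (A :&: orthov b W^C = 0)%VS.
  apply/eqP; rewrite -subv0 -(eqP nd) -(addv_complf W) orthov_add.
  by rewrite capvS // orthov_sym.
have := dim_le_cap_orthov A W^C; rewrite c0 dimv0 add0n dimv_compl.
by have := dimvS (subvf W); rewrite -/W; lia.
Qed.

Lemma orthovK A : orthov b (orthov b A) = A.
Proof.
apply/esym/eqP; rewrite eqEdim orthov_sym subvv /=.
by have := dim_orthov A; have := dim_orthov (orthov b A); lia.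
Qed.

Lemma orthov_cap A B : orthov b (A :&: B) = (orthov b A + orthov b B)%VS.
Proof. by rewrite -{1}(orthovK A) -{1}(orthovK B) -orthov_add orthovK. Qed.

End Orthogonal.

Record qmatroid (F : fieldType) (E : vectType F) := QMatroid {
  qrank :> {vspace E} -> int;
  qrank_bound : forall A, 0 <= qrank A <= (\dim A)%:Z;
  qrank_mono : forall A B, (A <= B)%VS -> qrank A <= qrank B;
  qrank_submod : forall A B,
    qrank (A + B)%VS + qrank (A :&: B)%VS <= qrank A + qrank B
}.

Section QMatroid.
Variables (F : fieldType) (E : vectType F) (M : qmatroid E).
Implicit Types A B e : {vspace E}.

Definition independent A : Prop := M A = (\dim A)%:Z.

Definition basis A : Prop := independent A /\ M A = M fullv.

Definition loop e : Prop := \dim e = 1%N /\ M e = 0.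

Definition isthmus (b : {symmetric E}) e : Prop :=
  \dim e = 1%N /\ forall B, basis B -> ~ (e <= orthov b B)%VS.

Lemma qrank_dim_mono A B :
  (A <= B)%VS -> M B + (\dim A)%:Z <= M A + (\dim B)%:Z.
Proof.
move=> sAB.
have AC : (A + (B :\: A) = B)%VS by rewrite addvC addv_diff; apply/addv_idPl.
have := qrank_submod M A (B :\: A); rewrite AC capvC capv_diff => h.
have /andP[h0 _] := qrank_bound M 0%VS.
have /andP[_ hd] := qrank_bound M (B :\: A).
have dB : (\dim B = \dim A + \dim (B :\: A))%N.
  by rewrite -{1}AC dimv_disjoint_sum // capvC capv_diff.
lia.
Qed.

End QMatroid.

Section Dual.
Variables (F : fieldType) (E : vectType F) (b : {symmetric E}).
Hypothesis nd : nondegenerate b.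
Variable M : qmatroid E.

Definition dual_rank (A : {vspace E}) : int :=
  (\dim A)%:Z - M fullv + M (orthov b A).

Fact dual_rank_bound A : 0 <= dual_rank A <= (\dim A)%:Z.
Proof.
have := qrank_dim_mono M (subvf (orthov b A)).
have := qrank_mono M (subvf (orthov b A)).
by have := dim_orthov nd A; rewrite /dual_rank; lia.
Qed.

Fact dual_rank_mono A B : (A <= B)%VS -> dual_rank A <= dual_rank B.
Proof.
move=> /(orthovS b)/(qrank_dim_mono M).
by have := dim_orthov nd A; have := dim_orthov nd B; rewrite /dual_rank; lia.
Qed.

Fact dual_rank_submod A B :
  dual_rank (A + B)%VS + dual_rank (A :&: B)%VS <= dual_rank A + dual_rank B.
Proof.
rewrite /dual_rank orthov_add (orthov_cap nd).
have := qrank_submod M (orthov b A) (orthov b B).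
by have := dimv_sum_cap A B; lia.
Qed.

Definition dual : qmatroid E :=
  QMatroid dual_rank_bound dual_rank_mono dual_rank_submod.

Lemma dual_not_loop e : ~ isthmus M b e -> ~ loop dual e.
Proof.
move=> ni [e1 /= re]; apply: ni; split=> // B [_ rB] eB.
have /(qrank_mono M) : (B <= orthov b e)%VS by rewrite orthov_sym.
by move: re; rewrite /dual_rank e1 rB; lia.
Qed.

End Dual.

Arguments dual {F E b} nd M.
Arguments dual_not_loop {F E b} nd {M e}.

Section Restriction.
Variables (F : fieldType) (E : vectType F) (U : {vspace E}) (M : qmatroid E).

Definition vsincl : 'Hom(subvs_of U, E) := linfun vsval.

Lemma vsinclE x : vsincl x = vsval x. Proof. exact: lfunE. Qed.

Lemma lker_vsincl : lker vsincl == 0%VS.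
Proof. by apply/lker0P=> x y; rewrite !vsinclE; apply: val_inj. Qed.

Lemma limg_vsincl : limg vsincl = U.
Proof.
apply/vspaceP=> x; apply/memv_imgP/idP => [[u _ ->] | xU].
  by rewrite vsinclE subvsP.
by exists (vsproj U x); rewrite ?memvf // vsinclE vsprojK.
Qed.

Definition restriction_rank (A : {vspace subvs_of U}) : int :=
  M (vsincl @: A)%VS.

Fact restriction_rank_bound A : 0 <= restriction_rank A <= (\dim A)%:Z.
Proof.
rewrite /restriction_rank -(limg_dim_eq (f := vsincl) (U := A)) ?qrank_bound //.
by rewrite (eqP lker_vsincl) capv0.
Qed.

Fact restriction_rank_mono A B :
  (A <= B)%VS -> restriction_rank A <= restriction_rank B.
Proof. by move=> AB; rewrite qrank_mono // limgS. Qed.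

Fact restriction_rank_submod A B :
  restriction_rank (A + B)%VS + restriction_rank (A :&: B)%VS
  <= restriction_rank A + restriction_rank B.
Proof.
by rewrite /restriction_rank limgD lker0_img_cap ?lker_vsincl ?qrank_submod.
Qed.

Definition restriction : qmatroid (subvs_of U) :=
  QMatroid restriction_rank_bound restriction_rank_mono restriction_rank_submod.

End Restriction.

Section Contraction.
Variables (F : fieldType) (E : vectType F) (e : {vspace E}) (M : qmatroid E).
Hypotheses (e1 : \dim e = 1%N) (nl : ~ loop M e).

(* The unique subspace containing [e] whose image in [E / e] is [A] is the
   preimage of [A]. *)
Definition contraction_rank (A : {vspace quotv e}) : int :=
  M (quotv_proj e @^-1: A)%VS - 1.

Let preim_ge A : (e <= quotv_proj e @^-1: A)%VS.
Proof. by rewrite -{1}(lker_quotv_proj e) -lpreim0 lpreimS // sub0v. Qed.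

Let preimK A : (quotv_proj e @: (quotv_proj e @^-1: A))%VS = A.
Proof. by rewrite lpreimK // limg_quotv_proj subvf. Qed.

Let dim_preim A : \dim (quotv_proj e @^-1: A) = (\dim A).+1.
Proof.
rewrite -(limg_ker_dim (quotv_proj e)) preimK lker_quotv_proj.
by rewrite (capv_idPr (preim_ge A)) e1.
Qed.

Let rank_e : M e = 1.
Proof.
have := qrank_bound M e; have : M e <> 0 by move=> re; apply: nl.
by rewrite e1; lia.
Qed.

Fact contraction_rank_bound A : 0 <= contraction_rank A <= (\dim A)%:Z.
Proof.
have := qrank_bound M (quotv_proj e @^-1: A); rewrite dim_preim.
have := qrank_mono M (preim_ge A); rewrite rank_e /contraction_rank.
by move: (M _) (\dim A) => r d; lia.
Qed.

Fact contraction_rank_mono A B :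
  (A <= B)%VS -> contraction_rank A <= contraction_rank B.
Proof. by move=> AB; rewrite lerD2r qrank_mono // lpreimS. Qed.

Fact contraction_rank_submod A B :
  contraction_rank (A + B)%VS + contraction_rank (A :&: B)%VS
  <= contraction_rank A + contraction_rank B.
Proof.
have := qrank_submod M (quotv_proj e @^-1: A) (quotv_proj e @^-1: B).
have -> : (quotv_proj e @^-1: A + quotv_proj e @^-1: B
           = quotv_proj e @^-1: (A + B))%VS.
  apply/eqP; rewrite eqEdim subv_add !lpreimS ?addvSl ?addvSr //=.
  rewrite dim_preim -{1}(preimK A) -{1}(preimK B) -limgD.
  rewrite -[X in (_ <= X)%N](limg_ker_dim (quotv_proj e)) lker_quotv_proj.
  rewrite (capv_idPr _) ?e1 //.
  exact: subv_trans (preim_ge A) (addvSl _ _).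
have -> : (quotv_proj e @^-1: A :&: quotv_proj e @^-1: B
           = quotv_proj e @^-1: (A :&: B))%VS.
  by apply/vspaceP=> x; rewrite memv_cap -!memv_preim memv_cap.
by rewrite /contraction_rank; lia.
Qed.

Definition contraction : qmatroid (quotv e) :=
  QMatroid contraction_rank_bound contraction_rank_mono contraction_rank_submod.

End Contraction.

Arguments contraction {F E e} M e1 nl.

Section Phi.
Variables (F : fieldType) (E : vectType F) (b : {symmetric E}).
Variable e : {vspace E}.

Definition perp_form : subvs_of (orthov b e) -> subvs_of (orthov b e) -> F :=
  pullback_form (vsincl (orthov b e)) b.

HB.instance Definition _ := Hermitian.on perp_form.

(* [phi] inverts the restriction to [e^perp] of the projection onto [E / e], so
   it maps a coset of [e] to its unique element orthogonal to [e]. *)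
Definition phi : 'Hom(quotv e, subvs_of (orthov b e)) :=
  ((quotv_proj e \o vsincl (orthov b e))^-1)%VF.

Definition quot_form : quotv e -> quotv e -> F := pullback_form phi perp_form.

HB.instance Definition _ := Hermitian.on quot_form.

Hypothesis nd : nondegenerate b.

(* When [e] is isotropic, [perp_form] is degenerate, so it defines no dual on
   [e^perp], and [A |-> A :&: e^perp] is not injective on the subspaces
   containing [e]: no isomorphism [E / e -> e^perp] can realize it. *)
Lemma perp_form_nondegenerateP :
  nondegenerate perp_form <-> (e :&: orthov b e = 0)%VS.
Proof.
split=> [nde | c0].
  apply/eqP; rewrite -subv0; apply/subvP=> x; rewrite memv_cap memv0.
  move=> /andP[xe xo]; rewrite -(vsprojK xo).
  suff /eqP-> : vsproj (orthov b e) x == 0 by rewrite linear0.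
  rewrite -memv0 -(eqP nde); apply/mem_orthovP=> y _ /=.
  rewrite /perp_form /pullback_form !vsinclE vsprojK // hermC mul1r /=.
  by have /mem_orthovP-> := subvsP y.
rewrite /nondegenerate -subv0; apply/subvP=> x /mem_orthovP x0.
suff : vsval x \in (e :&: orthov b e)%VS.
  by rewrite c0 !memv0 => /eqP x00; apply/eqP/val_inj.
rewrite memv_cap subvsP andbT.
suff : vsval x \in orthov b (orthov b e) by rewrite orthovK.
apply/mem_orthovP=> y yo; have := x0 (vsproj _ y) (memvf _).
by rewrite /= /perp_form /pullback_form !vsinclE vsprojK.
Qed.

Hypothesis nde : nondegenerate perp_form.

Let cap_orthov0 : (e :&: orthov b e = 0)%VS.
Proof. exact/perp_form_nondegenerateP. Qed.

Let g := (quotv_proj e \o vsincl (orthov b e))%VF.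

Lemma phiK : cancel g phi.
Proof.
apply: lker0_lfunK; rewrite -subv0; apply/subvP=> x.
rewrite memv_ker comp_lfunE vsinclE => xe.
have : vsval x \in (e :&: orthov b e)%VS.
  by rewrite memv_cap subvsP andbT -quotv_proj_eq0.
by rewrite cap_orthov0 !memv0 => /eqP x0; apply/eqP/val_inj.
Qed.

Lemma phiVK : cancel phi g.
Proof.
have full : (e + orthov b e = fullv)%VS.
  apply/eqP; rewrite eqEdim subvf /= dimv_disjoint_sum ?cap_orthov0 //.
  by rewrite addnC dim_orthov.
move=> x; apply: limg_lfunVK; suff -> : limg g = fullv by rewrite memvf.
rewrite limg_comp limg_vsincl -limg_quotv_proj -full limgD.
have /eqP-> : (quotv_proj e @: e == 0)%VS by rewrite -lkerE lker_quotv_proj.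
by rewrite add0v.
Qed.

Lemma lker_phi : lker phi = 0%VS.
Proof. by apply/eqP/lker0P; apply: can_inj phiVK. Qed.

Lemma limg_phi : limg phi = fullv.
Proof.
apply/eqP; rewrite eqEsubv subvf; apply/subvP=> x _.
by rewrite -(phiK x) memv_img ?memvf.
Qed.

Lemma phi_img (A : {vspace E}) : (e <= A)%VS ->
  (vsincl (orthov b e) @: (phi @: (quotv_proj e @: A)) = A :&: orthov b e)%VS.
Proof.
move=> eA; apply/vspaceP=> x; rewrite memv_cap; apply/idP/andP.
  move=> /memv_imgP[_ /memv_imgP[_ /memv_imgP[a aA ->] ->] ->].
  rewrite {2}vsinclE subvsP; split=> //.
  set y := vsincl _ _; rewrite -(subrK a y) rpredD // (subvP eA) //.
  rewrite -quotv_proj_eq0 linearB subr_eq0; apply/eqP.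
  by have := phiVK (quotv_proj e a); rewrite comp_lfunE.
move=> [xA xo]; rewrite -(vsprojK xo) -vsinclE memv_img //.
by rewrite -[vsproj _ _]phiK memv_img // comp_lfunE memv_img // vsinclE vsprojK.
Qed.

Lemma quot_form_nondegenerate : nondegenerate quot_form.
Proof.
rewrite /nondegenerate -subv0; apply/subvP=> x /mem_orthovP x0.
rewrite memv0; apply/eqP/(can_inj phiVK); rewrite linear0.
apply/eqP; rewrite -memv0 -(eqP nde); apply/mem_orthovP=> y _.
have /memv_imgP[z _ ->] : y \in limg phi by rewrite limg_phi memvf.
by apply: x0; rewrite memvf.
Qed.

End Phi.

Arguments perp_form {F E} b e x y.
Arguments quot_form {F E} b e x y.

Definition qmatroid_iso (F : fieldType) (E1 E2 : vectType F)
    (f : 'Hom(E1, E2)) (M1 : qmatroid E1) (M2 : qmatroid E2) : Prop :=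
  [/\ lker f = 0%VS, limg f = fullv & forall A, M1 A = M2 (f @: A)%VS].

(* Main.v *)
(** For a subspace [P] containing [e], the image of [P / e] under [phi] is
    [P :&: e^perp], and the orthogonal complement of the latter inside [e^perp]
    is [e^perp :&: (P^perp + e)], which is [P^perp] by the modular law because
    [e :&: e^perp = 0].  The orthogonal complement of [P / e] in [E / e] thus
    has preimage [e + P^perp].  Both equalities of rank functions then reduce to
    counting dimensions, using for the first one that [r(e^perp) = r(E)] because
    [e] is not an isthmus. *)
Require Import Defs.
From HB Require Import structures.
From mathcomp Require Import all_boot all_order all_algebra sesquilinear.
From mathcomp Require Import zify.

Set Implicit Arguments.
Unset Strict Implicit.
Unset Printing Implicit Defensive.

Import Order.TTheory GRing.Theory Num.Theory.
Local Open Scope ring_scope.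

(** Both [perp_form] and [quot_form] are pullbacks, along [vsincl] and [phi], so this carries
    complements in [e^perp] and [E / e] back to complements for [b]. *)
Lemma orthov_pullback (F : fieldType) (E1 E2 : vectType F) (f : 'Hom(E1, E2))
    (b : {symmetric E2}) (A : {vspace E1}) :
  orthov (pullback_form f b) A = (f @^-1: orthov b (f @: A))%VS.
Proof.
apply/vspaceP=> x; rewrite -memv_preim; apply/mem_orthovP/mem_orthovP => xA y.
  by move=> /memv_imgP[z zA ->]; apply: xA.
by move=> yA; apply: xA; apply: memv_img.
Qed.

Lemma vspace_modularl (F : fieldType) (E : vectType F) (A B C : {vspace E}) :
  (A <= C)%VS -> (C :&: (A + B) = A + (C :&: B))%VS.
Proof.
move=> sAC; apply/eqP; rewrite eqEsubv; apply/andP; split; last first.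
  by rewrite subv_add !subv_cap sAC addvSl capvSl (subv_trans (capvSr _ _)) ?addvSr.
apply/subvP=> x; rewrite memv_cap => /andP[xC /memv_addP[a aA [c cB xE]]].
rewrite xE memv_add // memv_cap cB andbT.
have -> : c = x - a by rewrite xE addrC addKr.
by rewrite rpredB // (subvP sAC).
Qed.

Lemma not_loop_rank (F : fieldType) (E : vectType F) (M : qmatroid E)
    (e : {vspace E}) : \dim e = 1%N -> ~ loop M e -> M e = 1.
Proof.
move=> e1 nl; have := qrank_bound M e; rewrite e1.
have : M e <> 0 by move=> re; apply: nl.
lia.
Qed.

(** A non-isthmus is not a loop of the dual, so its dual rank [1 - r(E) + r(e^perp)] is 1. *)
Lemma not_isthmus_rank (F : fieldType) (E : vectType F) (b : {symmetric E})
    (nd : nondegenerate b) (M : qmatroid E) (e : {vspace E}) :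
  \dim e = 1%N -> ~ isthmus M b e -> M (orthov b e) = M fullv.
Proof.
move=> e1 /(dual_not_loop nd)/(not_loop_rank e1) /=.
by rewrite /dual_rank e1; lia.
Qed.

Section QuotientPreimage.
Variables (F : fieldType) (E : vectType F) (e : {vspace E}).
Implicit Types A : {vspace quotv e}.

Lemma sub_quotv_preim A : (e <= quotv_proj e @^-1: A)%VS.
Proof. by rewrite -{1}(lker_quotv_proj e) -lpreim0 lpreimS // sub0v. Qed.

Lemma quotv_preimK A : (quotv_proj e @: (quotv_proj e @^-1: A))%VS = A.
Proof. by rewrite lpreimK // limg_quotv_proj subvf. Qed.

Lemma dim_quotv_preim A :
  \dim (quotv_proj e @^-1: A) = (\dim e + \dim A)%N.
Proof.
rewrite -(limg_ker_dim (quotv_proj e)) quotv_preimK lker_quotv_proj.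
by rewrite (capv_idPr (sub_quotv_preim A)).
Qed.

Lemma quotv_preimf : (quotv_proj e @^-1: fullv = fullv)%VS.
Proof. by apply/vspaceP=> x; rewrite -memv_preim !memvf. Qed.

End QuotientPreimage.

Section Minors.
Variables (F : fieldType) (E : vectType F) (b : {symmetric E}).
Variable e : {vspace E}.
Hypotheses (nd : nondegenerate b) (nde : nondegenerate (perp_form b e)).

Local Notation W := (orthov b e).
Local Notation preim A := (quotv_proj e @^-1: A)%VS.

Lemma cap_orthov_eq0 : (e :&: W = 0)%VS.
Proof. exact/(perp_form_nondegenerateP e nd). Qed.

Lemma add_orthov_full : (e + W = fullv)%VS.
Proof.
apply/eqP; rewrite eqEdim subvf /= dimv_disjoint_sum ?cap_orthov_eq0 //.
by rewrite addnC dim_orthov.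
Qed.

Lemma vsincl_phi (A : {vspace quotv e}) :
  (vsincl W @: (phi b e @: A) = preim A :&: W)%VS.
Proof. by rewrite -{1}(quotv_preimK A) phi_img // sub_quotv_preim. Qed.

Lemma dim_phi (A : {vspace quotv e}) : \dim (phi b e @: A) = \dim A.
Proof. by apply: limg_dim_eq; rewrite lker_phi // capv0. Qed.

Lemma dim_vsincl_phi (A : {vspace quotv e}) :
  \dim (vsincl W @: (phi b e @: A)) = \dim A.
Proof.
by rewrite limg_dim_eq ?dim_phi // (eqP (lker_vsincl W)) capv0.
Qed.

Lemma orthov_cap_perp (A : {vspace quotv e}) :
  orthov b (preim A :&: W) = (orthov b (preim A) + e)%VS.
Proof. by rewrite orthov_cap // orthovK. Qed.

Lemma vsincl_orthov_phi (A : {vspace quotv e}) :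
  (vsincl W @: orthov (perp_form b e) (phi b e @: A) = orthov b (preim A))%VS.
Proof.
rewrite orthov_pullback vsincl_phi orthov_cap_perp.
(* The pullback along the inclusion of [W] amounts to intersecting with [W]. *)
have -> (B : {vspace E}) : (vsincl W @: (vsincl W @^-1: B) = W :&: B)%VS.
  rewrite -[W in RHS]limg_vsincl; apply/vspaceP=> x; rewrite memv_cap.
  apply/memv_imgP/andP => [[y yB ->] | [/memv_imgP[y _ ->] yB]].
    by rewrite memv_img ?memvf // memv_preim.
  by exists y; rewrite -?memv_preim.
(* The modular law applies because [e <= preim A] gives [orthov b (preim A) <= W]. *)
rewrite vspace_modularl ?orthovS ?sub_quotv_preim //.
by rewrite capvC cap_orthov_eq0 addv0.
Qed.

(** A subspace [Q] containing [e] is determined by its trace on [W]: since [e + W] is everything,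
    the modular law gives [Q = e + (Q :&: W)]. *)
Lemma preim_orthov_quot (A : {vspace quotv e}) :
  preim (orthov (quot_form b e) A) = (orthov b (preim A) + e)%VS.
Proof.
set Q := preim _.
(* As [phi] is onto, it maps the complement for [quot_form] onto the one for [perp_form]. *)
have QW : (Q :&: W = orthov b (preim A))%VS.
  rewrite -vsincl_phi orthov_pullback lpreimK ?vsincl_orthov_phi //.
  by rewrite limg_phi // subvf.
rewrite addvC -QW -vspace_modularl ?sub_quotv_preim //.
by rewrite add_orthov_full capvf.
Qed.

Variable M : qmatroid E.
Hypothesis e1 : \dim e = 1%N.

Lemma contraction_dual_iso (nie : ~ isthmus M b e) :
  qmatroid_iso (phi b e) (contraction (dual nd M) e1 (dual_not_loop nd nie))
    (dual nde (restriction W M)).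
Proof.
split=> [||A]; [exact: lker_phi | exact: limg_phi |].
rewrite /= /contraction_rank /= /dual_rank /= /restriction_rank.
rewrite dim_quotv_preim dim_phi vsincl_orthov_phi limg_vsincl.
(* With [P = preim A], the sides are [(dim A + 1) - r(E) + r(P^perp) - 1] and
   [dim A - r(W) + r(P^perp)]. *)
by rewrite (not_isthmus_rank nd e1 nie) e1; lia.
Qed.

Lemma dual_contraction_iso (nle : ~ loop M e) :
  qmatroid_iso (phi b e)
    (dual (quot_form_nondegenerate nd nde) (contraction M e1 nle))
    (restriction W (dual nd M)).
Proof.
split=> [||A]; [exact: lker_phi | exact: limg_phi |].
rewrite /= /restriction_rank /= /dual_rank /= /contraction_rank.
rewrite dim_vsincl_phi vsincl_phi orthov_cap_perp preim_orthov_quot.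
(* The contraction has total rank [r(E) - 1]; this [- 1] cancels the one in the rank of the
   complement. *)
by rewrite quotv_preimf; move: (\dim A) (M fullv) (M _) => d x y; lia.
Qed.

End Minors.

(** The hypothesis [nde] makes explicit that [e] is not isotropic, which the isomorphism [phi] and
    the duals on [e^perp] and [E / e] presuppose. *)
Theorem theorem8p10 (F : fieldType) (n : nat) (M : qmatroid 'rV[F]_n)
    (e : {vspace 'rV[F]_n})
    (e1 : \dim e = 1%N)
    (nle : ~ loop M e)
    (nie : ~ isthmus M (dotrv F n) e)
    (nde : nondegenerate (perp_form (dotrv F n) e)) :
  let nd := @dotrv_nondegenerate F n in
  let Mdual := dual nd M in
  let eperp := orthov (dotrv F n) e in
  qmatroid_iso (phi (dotrv F n) e)
    (contraction Mdual e1 (dual_not_loop nd nie))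
    (dual nde (restriction eperp M))
  /\
  qmatroid_iso (phi (dotrv F n) e)
    (dual (quot_form_nondegenerate nd nde) (contraction M e1 nle))
    (restriction eperp Mdual).
Proof.
by split; [exact: contraction_dual_iso | exact: dual_contraction_iso].
Qed.
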